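(* Let $\theta$ be irrational and $f(n)=e^{2\pi i n^2\theta}$ for $n\in\mathbb{N}$. Then: (i) for all $l\neq m$ in $\mathbb{N}$ and every mean state $E$, $\langle A^lf,A^mf\rangle_E=0$; (ii) for every asymptotically periodic $g\in l^\infty(\mathbb{N})$ and every mean state $E$, $E(f\overline{g})=0$.
   Context: $\mathbb{N}=\{0,1,\ldots\}$, $(Af)(n)=f(n+1)$. A mean state is a functional $E_\omega(f)=\lim_{n\to\omega}\frac1n\sum_{j=0}^{n-1}f(j)$ with $\omega$ a free ultrafilter on $\mathbb{N}$; $\langle f,g\rangle_E=E(f\overline g)$, $\|f\|_E=E(|f|^2)^{1/2}$. A function $g\in l^\infty(\mathbb{N})$ is asymptotically periodic if for every mean state $E$ there is a sequence $(n_j)$ of positive integers with $\|g-A^{n_j}g\|_E\to0$. *)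

(* Defs.v *)
From HB Require Import structures.
From mathcomp Require Import all_boot all_order all_algebra.
From mathcomp Require Import complex.
From mathcomp Require Import all_classical all_reals all_analysis.

Set Implicit Arguments.
Unset Strict Implicit.
Unset Printing Implicit Defensive.

Import Order.TTheory GRing.Theory Num.Theory.
Import numFieldNormedType.Exports.

Local Open Scope classical_set_scope.
Local Open Scope ring_scope.
Local Open Scope complex_scope.

(* The complex numbers R[i] have no topology of their own in the library;
   the normed-module structure over themselves is carried by R[i]^o. *)
Notation Cplx R := (R[i]^o) (only parsing).

Section MeanStates.
Variable R : realType.
Implicit Types (f g : nat -> Cplx R) (E : (nat -> Cplx R) -> Cplx R).

Definition translate f : nat -> Cplx R := fun n => f n.+1.

Definition free_ultrafilter (omega : set_system nat) : Prop :=
  UltraFilter omega /\ \bigcap_(S in omega) S = set0.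

(* For bounded f the limit exists; elsewhere lim returns a default value.
   The n = 0 term is 0, and is irrelevant since omega is free. *)
Definition omega_mean (omega : set_system nat) f : Cplx R :=
  lim (((n%:R : R[i])^-1 * \sum_(0 <= j < n) f j : Cplx R) @[n --> omega]).

Definition mean_state E : Prop :=
  exists omega : set_system nat, free_ultrafilter omega /\ E = omega_mean omega.

Definition inner_E E f g : Cplx R := E (fun n => f n * (g n)^*).

Definition norm_E E f : Cplx R := sqrtC (E (fun n => `|f n| ^+ 2)).

Definition asymptotically_periodic g : Prop :=
  forall E, mean_state E ->
    exists n_ : nat -> nat, (forall j, (0 < n_ j)%N) /\
      (norm_E E (g \- iter (n_ j) translate g) @[j --> \oo] --> (0 : Cplx R)).

Definition expi (t : R) : Cplx R := cos t +i* sin t.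

Definition quadratic_phase (theta : R) : nat -> Cplx R :=
  fun n => expi (2 * pi * n%:R ^+ 2 * theta).

End MeanStates.

(* Main.v *)
Require Import Defs.
From mathcomp Require Import all_boot all_order all_algebra.
From mathcomp Require Import complex.
From mathcomp Require Import all_classical all_reals all_analysis.
From mathcomp Require Import ring lra.

(** Correlations of the quadratic phase f are geometric sums with ratio
    e(2 (l - m) theta) <> 1, so their Cesaro means vanish; this is (i).  For
    (ii), let A^p g be within s of g in mean square.  Then A^(kp) g stays within
    k s of g, and shift invariance of the mean gives, on averaging over k < K,
      E(f g^* ) = E((1/K) (sum_k A^(kp) f) g^* ) + O(K s).
    By (i) the translates A^(kp) f are orthonormal, so their average has norm
    K^(-1/2).  Taking K = N^2 and s = N^(-3), both terms are O(1/N). *)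

Set Implicit Arguments.
Unset Strict Implicit.
Unset Printing Implicit Defensive.

Import Order.TTheory GRing.Theory Num.Theory.
Import numFieldNormedType.Exports.

Local Open Scope classical_set_scope.
Local Open Scope ring_scope.
Local Open Scope complex_scope.

(** * Asymptotic bounds on Cesaro means along a filter *)

Section MeanBounds.
Variables (R : realType) (F : set_system nat).
Hypotheses (FF : Filter F) (Foo : F --> \oo).
Local Notation C := R[i].
Implicit Types (u v w : nat -> C) (a c s B : C).

Definition cesaro u (n : nat) : C := n%:R^-1 * \sum_(0 <= j < n) u j.

(* Bounds limsup_F |cesaro u|, the modulus of the mean rather than the mean of
   the modulus; it makes sense whether or not the mean converges. *)
Definition mean_le u c :=
  forall e : C, 0 < e -> \forall n \near F, `|cesaro u n| < c + e.

Lemma mean_le_weaken u c c' : c <= c' -> mean_le u c -> mean_le u c'.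
Proof.
move=> cc' uc e /uc; apply: filterS => n /lt_le_trans; apply.
by rewrite lerD2r.
Qed.

Lemma mean_le_dominated u w c :
  (forall n, `|u n| <= w n) -> mean_le w c -> mean_le u c.
Proof.
move=> uw wc e /wc; apply: filterS => n; apply: le_lt_trans.
rewrite /cesaro !normrM ler_wpM2l// (le_trans (ler_norm_sum _ _ _))//.
rewrite [leRHS]ger0_norm ?sumr_ge0// => [|i _]; last exact: le_trans (uw i).
exact: ler_sum.
Qed.

Lemma mean_leD u v c d :
  mean_le u c -> mean_le v d -> mean_le (fun n => u n + v n) (c + d).
Proof.
move=> uc vd e e0; have e20 : 0 < e / 2 by rewrite divr_gt0.
apply: filterS2 (uc _ e20) (vd _ e20) => n un vn.
rewrite /cesaro big_split/= mulrDr (le_lt_trans (ler_normD _ _))//.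
by rewrite [e]splitr addrACA ltrD.
Qed.

Lemma mean_leN u c : mean_le u c -> mean_le (fun n => - u n) c.
Proof.
move=> uc e /uc; apply: filterS => n.
by rewrite /cesaro sumrN mulrN normrN.
Qed.

Lemma mean_leB u v c d :
  mean_le u c -> mean_le v d -> mean_le (fun n => u n - v n) (c + d).
Proof. by move=> uc /mean_leN; exact: mean_leD. Qed.

Lemma mean_leM a u c : a != 0 ->
  mean_le u c -> mean_le (fun n => a * u n) (`|a| * c).
Proof.
rewrite -normr_gt0 => a0 uc e e0.
apply: filterS (uc _ (divr_gt0 e0 a0)) => n un.
have -> : cesaro (fun j => a * u j) n = a * cesaro u n.
  by rewrite /cesaro -mulr_sumr mulrCA.
rewrite normrM (lt_le_trans (_ : _ < `|a| * (c + e / `|a|)))//.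
  by rewrite ltr_pM2l.
by rewrite mulrDr [`|a| * (_ / _)]mulrC divfK ?gt_eqF.
Qed.

Lemma mean_le_bounded u c : (forall n, `|u n| <= c) -> mean_le u c.
Proof.
move=> uc e e0; apply: nearW => n; apply: (@le_lt_trans _ _ c); last first.
  by rewrite ltrDl.
(* At [n = 0] the convention that 0 has inverse 0 makes the mean vanish, and [0 <= c] comes from the
   bound on [u 0]. *)
have [->|n0] := posnP n.
  by rewrite /cesaro invr0 mul0r normr0 (le_trans _ (uc 0%N)).
rewrite /cesaro normrM normfV normr_nat ler_pdivrMl ?ltr0n//.
rewrite (le_trans (ler_norm_sum _ _ _))//.
rewrite (le_trans (ler_sum _ (fun i _ => uc i)))//.
by rewrite sumr_const_nat subn0 mulr_natl.
Qed.

Lemma mean_le_sum (K : nat) (u : nat -> nat -> C) (c : nat -> C) :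
  (forall k, (k < K)%N -> mean_le (u k) (c k)) ->
  mean_le (fun n => \sum_(0 <= k < K) u k n) (\sum_(0 <= k < K) c k).
Proof.
elim: K => [_|K IH uc].
  by apply: mean_le_bounded => n; rewrite !big_geq// normr0.
rewrite big_nat_recr//=; under eq_fun do rewrite big_nat_recr//=.
by apply: mean_leD; [apply: IH => k kK; apply: uc; exact: ltnW|exact: uc].
Qed.

Lemma near_divr_nat_lt B e : 0 <= B -> 0 < e ->
  \forall n \near \oo, B / n%:R < e :> C.
Proof.
(* The order of [R[i]] forces [B] and [e] to have zero imaginary part, which reduces the claim to
   real numbers. *)
case: B => b b'; rewrite lecE/= => /andP[/eqP -> b0].
case: e => e e'; rewrite ltcE/= => /andP[/eqP -> e0].
near=> n; have n0 : 0 < n%:R :> R by near: n; exact: nbhs_infty_gtr.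
rewrite -(rmorph_nat (real_complex R)) -fmorphV/= -[_ +i* _]/(b%:C).
rewrite -rmorphM/= ltcR ltr_pdivrMr// mulrC -ltr_pdivrMr//.
by near: n; exact: nbhs_infty_gtr.
Unshelve. all: by end_near. Qed.

Lemma mean_le0 u B : (forall n, `|\sum_(0 <= j < n) u j| <= B) -> mean_le u 0.
Proof.
move=> uB e e0; have B0 : 0 <= B by exact: le_trans (uB 0%N).
have := Foo (near_divr_nat_lt B0 e0); apply: filterS => n Bn.
rewrite add0r (le_lt_trans _ Bn)// /cesaro normrM mulrC normfV normr_nat.
by rewrite ler_wpM2r.
Qed.

(** The difference is a sum of [m] one-step differences. The partial sums of each telescope to two
    boundary terms, so they stay below [B + B]. *)
Lemma mean_le_subshift u m B : (forall n, `|u n| <= B) ->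
  mean_le (fun n => u n - u (n + m)%N) 0.
Proof.
move=> uB.
have -> : (fun n => u n - u (n + m)%N)
    = (fun n => \sum_(0 <= i < m) (u (n + i) - u (n + i.+1)%N)).
  apply/funext => n; rewrite -[RHS]opprK -sumrN.
  under eq_bigr do rewrite opprB.
  by rewrite (telescope_sumr (fun i => u (n + i)%N))// addn0 opprB.
have := @mean_le_sum m (fun k n => u (n + k)%N - u (n + k.+1)%N) (fun=> 0).
rewrite big1//; apply=> k _; apply: (@mean_le0 _ (B + B)) => n.
rewrite -normrN -sumrN; under eq_bigr do rewrite opprB -addSnnS.
rewrite (telescope_sumr (fun j => u (j + k)%N))//.
by rewrite (le_trans (ler_normB _ _))// lerD.
Qed.

Lemma mean_le_shift u m B c : (forall n, `|u n| <= B) ->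
  mean_le u c -> mean_le (fun n => u (n + m)%N) c.
Proof.
move=> uB uc; rewrite -[c]addr0.
have -> : (fun n => u (n + m)%N) = (fun n => u n - (u n - u (n + m)%N)).
  by apply/funext => n; rewrite opprB addrC subrK.
apply: mean_leB => //; exact: mean_le_subshift uB.
Qed.

(* By AM-GM, [2 s |u| <= s^2 + |u|^2]. *)
Lemma mean_le_sqr u s : 0 < s ->
  mean_le (fun n => `|u n| ^+ 2) (s ^+ 2) ->
  mean_le (fun n => `|u n|) s.
Proof.
move=> s0 us.
have s2 : (2 * s)^-1 != 0 by rewrite invr_eq0 gt_eqF// mulr_gt0.
have := mean_leM s2 (mean_leD (mean_le_bounded (fun=> lexx `|s ^+ 2|)) us).
have -> : `|(2 * s)^-1| * (`|s ^+ 2| + s ^+ 2) = s.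
  rewrite normfV !ger0_norm ?mulr_ge0 ?exprn_ge0 ?ltW//.
  by field; rewrite gt_eqF.
apply: mean_le_dominated => n.
rewrite normr_id mulrC ler_pdivlMr ?mulr_gt0// -subr_ge0.
have -> : s ^+ 2 + `|u n| ^+ 2 - `|u n| * (2 * s) = (s - `|u n|) ^+ 2.
  by rewrite sqrrB mulr_natl mulrnAr (mulrC s) addrAC.
by rewrite real_exprn_even_ge0// rpredB// ?normr_real// gtr0_real.
Qed.

Lemma cesaro_cvg0 u : (forall c, 0 < c -> mean_le u c) ->
  (cesaro u n : Cplx R) @[n --> F] --> (0 : Cplx R).
Proof.
move=> uc; apply/cvgr0Pnorm_lt => e e0.
have e20 : 0 < e / 2 by rewrite divr_gt0.
by have := uc _ e20 _ e20; rewrite -splitr.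
Qed.

End MeanBounds.

(** * The character [expi] and the correlations of the quadratic phase *)

Section Expi.
Variable R : realType.
Implicit Types (s t theta : R).

Lemma expi0 : expi 0 = 1 :> R[i].
Proof. by rewrite /expi cos0 sin0. Qed.

Lemma expiD s t : expi (s + t) = expi s * expi t :> R[i].
Proof. by rewrite /expi cosD sinD; simpc; rewrite [sin s * _ + _]addrC. Qed.

Lemma expi_conj t : ((expi t)^*)%R = expi (- t).
Proof. by rewrite /expi cosN sinN. Qed.

Lemma norm_expi t : `|expi t : R[i]| = 1.
Proof.
apply/eqP; rewrite -(@eqrXn2 _ 2)//; apply/eqP.
by rewrite expr1n normCK expi_conj -expiD subrr expi0.
Qed.

Lemma expiMn t n : expi (t *+ n) = expi t ^+ n :> R[i].
Proof.
by elim: n => [|n IH]; rewrite ?mulr0n ?expi0// mulrS expiD IH exprS.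
Qed.

Lemma expi_2piMz (k : int) : expi (pi *+ 2 *~ k) = 1 :> R[i].
Proof.
have e1 : expi (pi *+ 2) = 1 :> R[i] by rewrite /expi cos2pi sin2pi.
case: k => n; first by rewrite -pmulrn expiMn e1 expr1n.
by rewrite NegzE mulrNz -pmulrn -expi_conj expiMn e1 expr1n conjC1.
Qed.

(** Reduce [t] modulo 2 pi to [r] in [0, 2 pi). Then cos r = 1 - 2 sin^2(r/2) gives sin(r/2) = 0,
    and since sine is positive on (0, pi), [r] is 0. *)
Lemma expi_eq1 t : expi t = 1 :> R[i] -> exists k : int, t = pi *+ 2 *~ k.
Proof.
move=> t1; have pi20 : 0 < pi *+ 2 :> R by rewrite mulrn_wgt0// pi_gt0.
pose k := Num.floor (t / (pi *+ 2)); exists k.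
pose r := t - pi *+ 2 *~ k.
have r0 : 0 <= r.
  by rewrite subr_ge0 -mulrzr mulrC -ler_pdivlMr// floor_le.
have r2 : r < pi *+ 2.
  rewrite ltrBlDr -{1}[pi *+ 2]mulr1 -mulrzr -mulrDr mulrC -ltr_pdivrMr//.
  by rewrite addrC -[1]/(1%:~R) -intrD floorD1_gt.
have : expi r = 1 :> R[i] 
  by rewrite /r expiD t1 -expi_conj expi_2piMz conjC1 mulr1.
have -> : r = (r / 2) *+ 2 by rewrite -mulr_natr divfK.
case; rewrite cos_mulr2n cos2sin2 => cr _.
have : sin (r / 2) = 0.
  by apply/eqP; rewrite -sqrf_eq0; apply/eqP; lra.
have [/eqP|r_neq0] := eqVneq r 0; first by rewrite subr_eq0 => /eqP.
have r_gt0 : 0 < r by rewrite lt_def r_neq0.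
move/eqP; rewrite gt_eqF// sin_gt0_pi// divr_gt0//=.
by rewrite ltr_pdivrMr// mulr_natr.
Qed.

(** The squares of [n] cancel in (n + l)^2 - (n + m)^2, leaving an exponent affine in [n]: a
    constant phase times a geometric sequence. *)
Lemma quadratic_phase_corr theta (l m n : nat) :
  quadratic_phase theta (n + l) * ((quadratic_phase theta (n + m))^*)%R =
  expi (2 * pi * (l%:R ^+ 2 - m%:R ^+ 2) * theta) *
    expi (4 * pi * (l%:R - m%:R) * theta) ^+ n :> R[i].
Proof.
rewrite /quadratic_phase expi_conj -expiD -expiMn -expiD; congr expi.
by rewrite !natrD -mulr_natl; ring.
Qed.

Lemma irrational_expi_neq1 theta (l m : nat) : irrational theta -> l <> m ->
  expi (4 * pi * (l%:R - m%:R) * theta) != 1 :> R[i].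
Proof.
move=> irr lm; apply/eqP => /expi_eq1[k]; rewrite -mulrzr => ek; apply: irr.
have pi0 : pi != 0 :> R by rewrite gt_eqF// pi_gt0.
have d0 : l%:R - m%:R != 0 :> R by rewrite subr_eq0 eqr_nat; exact/eqP.
(* This rational solves 4 pi (l - m) theta = 2 pi k for theta. *)
exists (k%:~R / (2 * (l%:R - m%:R))) => //.
rewrite fmorph_div rmorphM rmorphB/= ratr_int !ratr_nat.
apply: (mulfI pi0); apply: (mulfI d0).
transitivity (pi *+ 2 * k%:~R / 4 : R); first by field.
by rewrite -ek; field.
Qed.

End Expi.

(** * Free ultrafilters and convergence of means along them *)

Section MeanStates.
Variable R : realType.
Local Notation C := R[i].
Implicit Types (u g : nat -> C) (s B : C).

(** Since the members of [omega] have empty intersection, each single integer is missed by some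
    member; intersecting such members removes 0, ..., N - 1 one at a time. *)
Lemma free_ultrafilter_cvgoo (omega : set_system nat) :
  free_ultrafilter omega -> omega --> \oo.
Proof.
move=> [U cap] A [N _ NA]; have FF := @ultra_proper _ omega U.
suff: omega [set n | (N <= n)%N] by exact: filterS.
elim: N {A NA} => [|N IH].
  by apply: filterS filterT.
have [S oS SN] : exists2 S, omega S & ~ S N.
  apply: contrapT => nS; have : (\bigcap_(S in omega) S) N.
    by move=> S oS; apply: contrapT => SN; apply: nS; exists S.
  by rewrite cap.
by apply: filterS2 IH oS => n /=; rewrite leq_eqVlt => /orP[/eqP <-//|//].
Qed.

(** Compactness of [0, B] gives a cluster point [l]. Either the indices with [b n] within [e] of [l]
    form a member of [omega], or their complement does, which contradicts clustering. *)
Lemma ultrafilter_bounded_cvg (omega : set_system nat) (b : nat -> R) (B : R) :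
  UltraFilter omega -> (forall n, 0 <= b n <= B) ->
  exists l : R, b n @[n --> omega] --> l.
Proof.
move=> U bB; have FF := @ultra_proper _ omega U.
have : (b n @[n --> omega]) `[0, B]%classic.
  apply: (@filterS _ omega _ setT) => [n _|]; last exact: filterT.
  by rewrite /= in_itv/=.
case/(@segment_compact _ 0 B _ _) => l [_ lcl]; exists l.
apply/cvgrPdist_lt => e e0.
have [//|far] := in_ultra_setVsetC [set n | `|l - b n| < e] U.
by have [x [/= lx]] :=
  lcl [set x | ~ (`|l - x| < e)] _ far (nbhsx_ballx l e e0).
Qed.

(** [omega_mean] is a [lim], informative only once convergence is known. This case serves the
    squared modulus inside [norm_E]; such means are real, so the real statement applies. *)
Lemma cesaro_cvg_ge0 (omega : set_system nat) u B :
  UltraFilter omega -> (forall n, 0 <= u n <= B) ->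
  cvg ((cesaro u n : Cplx R) @[n --> omega]).
Proof.
move=> U uB; have FF := @ultra_proper _ omega U.
have cB n : 0 <= cesaro u n <= B.
  apply/andP; split.
    by rewrite mulr_ge0// sumr_ge0// => i _; have /andP[] := uB i.
  have [->|n0] := posnP n.
    by rewrite /cesaro invr0 mul0r; have /andP[/le_trans] := uB 0; apply.
  rewrite /cesaro ler_pdivrMl ?ltr0n//.
  rewrite (le_trans (ler_sum _ (G := fun=> B) _))// => [i _|].
    by have /andP[] := uB i.
  by rewrite sumr_const_nat subn0 mulr_natl.
have [|l bl] := @ultrafilter_bounded_cvg omega
  (fun n => complex.Re (cesaro u n)) (complex.Re B) U.
  by move=> n; have := cB n; rewrite !lecE/= => /andP[/andP[_ ->] /andP[]].
apply/cvg_ex; exists (l%:C); apply/cvgrPdist_lt => e.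
case: e => e e'; rewrite ltcE/= => /andP[/eqP -> e0].
move/cvgrPdist_lt: bl => /(_ _ e0); apply: filterS => n ln.
have /andP[cn _] := cB n.
have -> : cesaro u n = (complex.Re (cesaro u n))%:C.
  by rewrite RRe_real// ger0_real.
by rewrite -rmorphB normc_def/= expr0n/= addr0 sqrtr_sqr ltcR.
Qed.

Lemma mean_le_norm_E (omega : set_system nat) (h : nat -> C) s B :
  UltraFilter omega -> (forall n, `|h n| <= B) ->
  `|norm_E (omega_mean omega) h| < s ->
  mean_le omega (fun n => `|h n| ^+ 2) (s ^+ 2).
Proof.
move=> U hB; have FF := @ultra_proper _ omega U.
have h2B n : 0 <= `|h n| ^+ 2 <= B ^+ 2.
  by rewrite exprn_ge0//= lerXn2r ?nnegrE// (le_trans _ (hB n)).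
have := cesaro_cvg_ge0 U h2B.
rewrite /norm_E /omega_mean -/(cesaro _ _); set L := lim _ => cL.
move=> Ls; have s0 : 0 <= s by rewrite ltW// (le_lt_trans _ Ls).
(* [norm_E] is the square root of [L], so its bound is squared. *)
have {}Ls : `|L| < s ^+ 2 by rewrite -(sqrtCK L) normrX ltrXn2r.
move=> e e0; move/cvgrPdist_lt: cL => /(_ _ e0); apply: filterS => n Ln.
rewrite -[X in `|X|](subrK L) (le_lt_trans (ler_normD _ _))// addrC.
by rewrite ltrD// distrC.
Qed.

End MeanStates.

(** * Orthonormality of the translates and the averaging estimate *)

Section QuadraticPhase.
Variables (R : realType) (theta : R) (F : set_system nat).
Hypotheses (FF : Filter F) (Foo : F --> \oo) (irr : irrational theta).
Local Notation C := R[i].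
Local Notation f := (quadratic_phase theta : nat -> C).
Implicit Types (g h : nat -> C) (s B c : C).

Lemma norm_quadratic_phase n : `|f n| = 1.
Proof. exact: norm_expi. Qed.

Lemma mean_le_quadratic_phase_corr (l m : nat) :
  mean_le F (fun n => f (n + l)%N * ((f (n + m)%N)^*)%R) (l == m)%:R.
Proof.
have [->|/eqP lm] := eqVneq l m.
  apply: mean_le_bounded => n.
  by rewrite normrM norm_conjC !norm_quadratic_phase mulr1.
under eq_fun do rewrite quadratic_phase_corr.
set z := expi (4 * _ * _ * _); set c := expi _.
have z1 : z - 1 != 0 :> C by rewrite subr_eq0 irrational_expi_neq1.
(* Multiplying the geometric sum by [z - 1] gives [z ^+ n - 1], of modulus at most 2. *)
apply: (@mean_le0 _ _ FF Foo _ (2 / `|z - 1|)) => n.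
rewrite -mulr_sumr normrM norm_expi mul1r ler_pdivlMr ?normr_gt0//.
rewrite mulrC -normrM big_mkord -subrX1 (le_trans (ler_normB _ _))//.
by rewrite normrX norm_expi expr1n normr1.
Qed.

(** Expand the squared modulus into correlations. As [p] is positive the shifts [k * p] are
    distinct, so only the [N ^ 2] diagonal terms contribute and the mean square is at most
    [N ^ 2]. *)
Lemma mean_le_quadratic_phase_sum (N p : nat) : (0 < N)%N -> (0 < p)%N ->
  mean_le F (fun n => `|\sum_(0 <= k < N ^ 2) f (n + k * p)%N|) N%:R.
Proof.
move=> N0 p0; apply: mean_le_sqr; rewrite ?ltr0n//.
have -> : (fun n => `|\sum_(0 <= k < N ^ 2) f (n + k * p)%N| ^+ 2) =
    (fun n => \sum_(0 <= k < N ^ 2) \sum_(0 <= i < N ^ 2)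
       f (n + k * p)%N * ((f (n + i * p)%N)^*)%R).
  apply/funext => n; rewrite normCK rmorph_sum mulr_suml.
  by apply: eq_bigr => k _; rewrite mulr_sumr.
have -> : N%:R ^+ 2 =
    \sum_(0 <= k < N ^ 2) \sum_(0 <= i < N ^ 2) (k * p == i * p)%N%:R :> C.
  transitivity (\sum_(0 <= k < N ^ 2) 1 : C).
    by rewrite sumr_const_nat subn0 -natrX.
  rewrite !big_mkord; apply: eq_bigr => k _.
  rewrite big_mkord (bigD1 k)//= eqxx.
  rewrite big1 ?addr0// => i ik; rewrite eqn_pmul2r//.
  by rewrite (inj_eq val_inj) eq_sym (negbTE ik).
apply: mean_le_sum => k _; apply: mean_le_sum => i _.
exact: mean_le_quadratic_phase_corr.
Qed.

(** Triangle inequality along the successive shifts by [p]: each of the [k] steps is a translate of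
    the first one, so shift invariance bounds its mean by [s] too. *)
Lemma mean_le_subshift_mul h p k s B : (forall n, `|h n| <= B) ->
  mean_le F (fun n => `|h n - h (n + p)%N|) s ->
  mean_le F (fun n => `|h n - h (n + k * p)%N|) (s *+ k).
Proof.
move=> hB hs; rewrite -[k in s *+ k]subn0 -sumr_const_nat.
have : mean_le F (fun n => \sum_(0 <= i < k)
    `|h (n + i * p)%N - h (n + i * p + p)%N|) (\sum_(0 <= i < k) s).
  apply: mean_le_sum => i _.
  apply: (@mean_le_shift _ _ FF Foo (fun n => `|h n - h (n + p)%N|)
    _ (B + B)) => // n.
  by rewrite normr_id (le_trans (ler_normB _ _))// lerD.
apply: mean_le_dominated => n.
rewrite normr_id (le_trans _ (ler_norm_sum _ _ _))//.
under eq_bigr do rewrite -addnA -mulSnr -opprB.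
by rewrite sumrN (telescope_sumr (fun i => h (n + i * p)%N))// addn0 opprB.
Qed.

Lemma mean_le_quadratic_phase_mul g (N p : nat) B :
  (0 < N)%N -> (0 < p)%N -> 0 < B -> (forall n, `|g n| <= B) ->
  mean_le F (fun n => `|g n - g (n + p)%N| ^+ 2) ((N%:R ^- 3) ^+ 2) ->
  mean_le F (fun n => f n * ((g n)^*)%R) ((B + 1) / N%:R).
Proof.
move=> N0 p0 B0 gB gp; set K := (N ^ 2)%N.
have N0' : 0 < N%:R :> C by rewrite ltr0n.
have {}gp : mean_le F (fun n => `|g n - g (n + p)%N|) (N%:R ^- 3).
  by apply: mean_le_sqr gp; rewrite invr_gt0 exprn_gt0.
pose u n := f n * ((g n)^*)%R.
have uB n : `|u n| <= B.
  by rewrite normrM norm_quadratic_phase mul1r norm_conjC.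
(* The sum [K * u n] is decomposed as [shifts + (orth - err)]: first [u n] is replaced by its
   shifts, then [g (n + k * p)] by [g n] inside them. *)
have shifts : mean_le F (fun n => \sum_(0 <= k < K) (u n - u (n + k * p)%N)) 0.
  have := @mean_le_sum _ _ FF K (fun k n => u n - u (n + k * p)%N) (fun=> 0).
  by rewrite big1//; apply=> k _; exact: mean_le_subshift uB.
have orth : mean_le F
    (fun n => (\sum_(0 <= k < K) f (n + k * p)%N) * ((g n)^*)%R) (B * N%:R).
  have := mean_leM FF (lt0r_neq0 B0) (mean_le_quadratic_phase_sum N0 p0).
  rewrite gtr0_norm//; apply: mean_le_dominated => n.
  by rewrite normrM norm_conjC mulrC ler_wpM2r.
have err : mean_le F (fun n => \sum_(0 <= k < K)
    f (n + k * p)%N * ((g n - g (n + k * p)%N)^*)%R) N%:R.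
  (* Bounding each [k] by [K] gives at most K^2 / N^3 = N. *)
  apply: (@mean_le_weaken _ _ FF _ (\sum_(0 <= k < K) (N%:R ^- 3 *+ k))).
    rewrite (@le_trans _ _ (\sum_(0 <= k < K) (N%:R ^- 3 *+ K)))//.
      rewrite !big_mkord ler_sum// => k _.
      by rewrite ler_wpMn2l ?invr_ge0 ?exprn_ge0// ltnW.
    rewrite sumr_const_nat subn0 -mulrnA -[leLHS]mulr_natr natrM /K natrX.
    by rewrite le_eqVlt; apply/orP; left; apply/eqP; field; rewrite gt_eqF.
  apply: mean_le_sum => k _; have := mean_le_subshift_mul k gB gp.
  apply: mean_le_dominated => n.
  by rewrite normrM norm_quadratic_phase mul1r norm_conjC.
have K0 : K%:R != 0 :> C by rewrite pnatr_eq0 -lt0n expn_gt0 N0.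
(* Dividing the total B N + N by K = N^2 leaves (B + 1) / N. *)
have := mean_leM FF (invr_neq0 K0) (mean_leD FF shifts (mean_leB FF orth err)).
have -> : `|K%:R^-1| * (0 + (B * N%:R + N%:R)) = (B + 1) / N%:R :> C.
  rewrite add0r ger0_norm ?invr_ge0// natrX; field.
  by rewrite gt_eqF.
congr mean_le; apply/funext => n.
rewrite mulr_suml -sumrB -big_split/= mulrC.
under eq_bigr do rewrite rmorphB mulrBr subKr subrK.
by rewrite sumr_const_nat subn0 -[_ *+ K]mulr_natr mulfK.
Qed.

End QuadraticPhase.

(** * Passage from the bounds to mean states *)

Lemma iter_translate (R : realType) (f : nat -> Cplx R) (m : nat) :
  iter m (@translate R) f = (fun n => f (n + m)%N).
Proof.
elim: m => [|m IH]; first by apply/funext => n; rewrite addn0.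
by rewrite iterS IH; apply/funext => n; rewrite /translate addSnnS.
Qed.

(** Arbitrarily small bounds make the Cesaro means converge to 0, and uniqueness of limits
    identifies [lim] with 0. *)
Lemma omega_mean_eq0 (R : realType) (omega : set_system nat) (u : nat -> R[i]) :
  free_ultrafilter omega -> (forall c, 0 < c -> mean_le omega u c) ->
  omega_mean omega u = 0.
Proof.
move=> [U _] uc; have FF := @ultra_proper _ omega U.
apply: (@cvg_lim (Cplx R) _ _ omega _ _ 0); first exact: norm_hausdorff.
exact: cesaro_cvg0.
Qed.

Lemma bounded_fun_pos (R : realType) (g : nat -> Cplx R) :
  bounded_fun g -> exists2 B : R[i], 0 < B & forall n, `|g n : R[i]| <= B.
Proof.
(* [bounded_fun] supplies bounds only strictly above [M]; adding 1 achieves this and makes the bound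
   positive. *)
move=> [M [Mr gM]]; exists (`|M| + 1); first by rewrite ltr_wpDl.
move=> n; apply: (gM _ _ n) => //.
by rewrite (le_lt_trans (real_ler_norm Mr))// ltrDl.
Qed.

Theorem theorem4p6 (R : realType) (theta : R) (htheta : irrational theta) :
  (forall (l m : nat) (E : (nat -> Cplx R) -> Cplx R),
      l <> m -> mean_state E ->
      inner_E E (iter l (@translate R) (quadratic_phase theta))
                (iter m (@translate R) (quadratic_phase theta)) = 0) /\
  (forall (g : nat -> Cplx R) (E : (nat -> Cplx R) -> Cplx R),
      bounded_fun g -> asymptotically_periodic g -> mean_state E ->
      E (fun n => quadratic_phase theta n * (g n)^*) = 0).
Proof.
split=> [l m E lm [omega [fo ->]]|g E gb gap sE].
  have FF := @ultra_proper _ omega fo.1.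
  apply: (omega_mean_eq0 fo) => c c0.
  rewrite !iter_translate; apply: (mean_le_weaken FF (ltW c0)).
  have := mean_le_quadratic_phase_corr FF (free_ultrafilter_cvgoo fo) htheta
    l m.
  by have /eqP/negbTE -> := lm.
have [B B0 gB] := bounded_fun_pos gb.
have [n_ [n_gt0 n_cvg]] := gap _ sE.
case: sE n_cvg => omega [fo ->] n_cvg.
have FF := @ultra_proper _ omega fo.1.
apply: (omega_mean_eq0 fo) => c c0.
(* [N] is fixed first, from [B] and [c]; only afterwards is a period [n_ j] chosen whose defect in
   norm is below [N ^- 3]. *)
have [N N0 Nc] : exists2 N, (0 < N)%N & (B + 1) / N%:R <= c.
  have [N _ Nc] := near_divr_nat_lt (addr_ge0 (ltW B0) ler01) c0.
  by exists N.+1 => //; apply/ltW/Nc => /=.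
apply: (mean_le_weaken FF Nc).
have s0 : 0 < N%:R ^- 3 :> R[i] by rewrite invr_gt0 exprn_gt0// ltr0n.
have [j _ /(_ j (leqnn j)) gj] := (cvgr0Pnorm_lt _).1 n_cvg _ s0.
apply: (mean_le_quadratic_phase_mul FF (free_ultrafilter_cvgoo fo) htheta N0
  (n_gt0 j) B0 gB).
apply: (@mean_le_norm_E _ _ _ _ (B + B) fo.1) => [n|].
  by rewrite (le_trans (ler_normB _ _))// lerD.
by move: gj; rewrite iter_translate.
Qed.
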